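(* There exists a (universal) sequence $(C(n))_{n \in \mathbb{N}} \in \mathbb{N}^{\mathbb{N}}$ such that, if $X$ is a set with $|X|\geq 2$, $\mathcal{B} \subset \mathrm{Br}(X)$ is a Hall set and $X_0 \in X$, then, for every $a < b \in \mathcal{B}$, $$\| [a, b] \|_{\mathcal{B}} \leq C(n(b))^{n_0(b)}\, (n(b))!,$$ where $n_0(b)$ denotes the number of occurrences of $X_0$ among the leaves of $b$ and $n(b) := |b|-n_0(b)$ the number of leaves of $b$ that are different from $X_0$.
   Context: The base field is $\mathbb{K}=\mathbb{R}$ or $\mathbb{C}$; $X$ is a set (possibly infinite) with at least two elements; $\mathbb{N}=\{0,1,2,\dots\}$. $\mathrm{Br}(X)$ is the free magma over $X$: the set of formal binary brackets (rooted planar binary trees with leaves labelled by elements of $X$), with product $(t_1,t_2)$. For $t\in \mathrm{Br}(X)$, $|t|$ is its number of leaves; if $t\notin X$, $t$ is written uniquely as $t=(\lambda(t),\mu(t))$. $\mathcal{L}(X)$ is the free Lie algebra over $X$ and $\mathrm{ev}:\mathrm{Br}(X)\to\mathcal{L}(X)$ is the canonical evaluation ($\mathrm{ev}(x)=x$ for $x\in X$, $\mathrm{ev}((t_1,t_2))=[\mathrm{ev}(t_1),\mathrm{ev}(t_2)]$). For $a,b\in\mathrm{Br}(X)$, $[a,b]$ denotes $[\mathrm{ev}(a),\mathrm{ev}(b)]\in\mathcal{L}(X)$. A Hall set is a subset $\mathcal{B}\subset\mathrm{Br}(X)$ endowed with a total order $<$ such that: (i) $X\subset\mathcal{B}$;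 (ii) for all $b_1,b_2\in\mathrm{Br}(X)$, $(b_1,b_2)\in\mathcal{B}$ iff $b_1,b_2\in\mathcal{B}$, $b_1<b_2$ and either $b_2\in X$ or $\lambda(b_2)\leq b_1$; (iii) for all $b_1,b_2\in\mathcal{B}$ with $(b_1,b_2)\in\mathcal{B}$, $b_1<(b_1,b_2)$. By a theorem of Viennot, $\mathrm{ev}$ is injective on $\mathcal{B}$ and $\mathrm{ev}(\mathcal{B})$ is a basis of $\mathcal{L}(X)$. For $u=\sum_{c\in\mathcal{B}}\alpha_c\,\mathrm{ev}(c)\in\mathcal{L}(X)$ (finite sum), $\|u\|_{\mathcal{B}}:=\sum_{c}|\alpha_c|$. *)

(* Defs.v *)
From HB Require Import structures.
From mathcomp Require Import all_boot all_order all_algebra finmap complex.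
From mathcomp Require Import boolp classical_sets reals constructive_ereal.

Set Implicit Arguments.
Unset Strict Implicit.
Unset Printing Implicit Defensive.

Import Order.TTheory GRing.Theory Num.Theory.
Local Open Scope ring_scope.

Inductive Br (X : Type) : Type :=
| leaf of X
| node of Br X & Br X.

Section BrChoice.
Variable X : choiceType.

Fixpoint Br_encode (t : Br X) : GenTree.tree X :=
  match t with
  | leaf x => GenTree.Leaf x
  | node l r => GenTree.Node 0 [:: Br_encode l; Br_encode r]
  end.

Fixpoint Br_decode (t : GenTree.tree X) : option (Br X) :=
  match t with
  | GenTree.Leaf x => Some (leaf x)
  | GenTree.Node _ [:: l; r] =>
      if (Br_decode l, Br_decode r) is (Some l', Some r')
      then Some (node l' r') else None
  | _ => None
  end.

Lemma Br_encodeK : pcancel Br_encode Br_decode.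
Proof. by elim=> //= l -> r ->. Qed.

HB.instance Definition _ := Choice.copy (Br X) (pcan_type Br_encodeK).

End BrChoice.

Fixpoint leaves (X : Type) (t : Br X) : seq X :=
  match t with
  | leaf x => [:: x]
  | node l r => leaves l ++ leaves r
  end.

Definition br_size (X : Type) (t : Br X) : nat := size (leaves t).

Definition occ (X : eqType) (X0 : X) (t : Br X) : nat := count_mem X0 (leaves t).

Definition occ_other (X : eqType) (X0 : X) (t : Br X) : nat :=
  (br_size t - occ X0 t)%N.

(* Only the values of [lt] on [B] matter. *)

Record is_Hall_set (X : Type) (B : set (Br X)) (lt : Br X -> Br X -> Prop) :
    Prop := IsHallSet {
  Hall_irr : forall t, B t -> ~ lt t t;
  Hall_trans : forall t1 t2 t3, B t1 -> B t2 -> B t3 ->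
    lt t1 t2 -> lt t2 t3 -> lt t1 t3;
  Hall_total : forall t1 t2, B t1 -> B t2 -> [\/ lt t1 t2, t1 = t2 | lt t2 t1];
  Hall_leaf : forall x, B (leaf x);
  Hall_node : forall b1 b2, B (node b1 b2) <->
    [/\ B b1, B b2, lt b1 b2 &
        match b2 with
        | leaf _ => True
        | node l _ => lt l b1 \/ l = b1
        end];
  Hall_lt_node : forall b1 b2, B b1 -> B b2 -> B (node b1 b2) ->
    lt b1 (node b1 b2)
}.

HB.mixin Record isLieAlgebra (K : fieldType) L of GRing.Lmodule K L := {
  lie : L -> L -> L;
  lie_linearl : forall (a : K) (u v w : L),
    lie (a *: u + v) w = a *: lie u w + lie v w;
  lie_linearr : forall (a : K) (u v w : L),
    lie w (a *: u + v) = a *: lie w u + lie w v;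
  lie_alt : forall u : L, lie u u = 0;
  lie_jacobi : forall u v w : L,
    lie u (lie v w) + lie v (lie w u) + lie w (lie u v) = 0
}.

#[short(type="lieAlgType")]
HB.structure Definition LieAlgebra (K : fieldType) :=
  { L of isLieAlgebra K L & GRing.Lmodule K L }.

Definition lie_morphism (K : fieldType) (L M : lieAlgType K)
    (phi : {linear L -> M}) : Prop :=
  forall u v : L, phi (lie u v) = lie (phi u) (phi v).

(* [L], with generators [iota x], is the free Lie algebra over [X]. *)
Definition is_free_lie (K : fieldType) (X : Type) (L : lieAlgType K)
    (iota : X -> L) : Prop :=
  forall (M : lieAlgType K) (f : X -> M),
    exists phi : {linear L -> M},
      [/\ lie_morphism phi,
          forall x, phi (iota x) = f x &
          forall psi : {linear L -> M}, lie_morphism psi ->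
            (forall x, psi (iota x) = f x) -> psi =1 phi].

Fixpoint ev (K : fieldType) (X : Type) (L : lieAlgType K) (iota : X -> L)
    (t : Br X) : L :=
  match t with
  | leaf x => iota x
  | node l r => lie (ev iota l) (ev iota r)
  end.

(* [alpha] is a family of coordinates of [u] with respect to [ev B]. *)
Definition Hall_coords (K : fieldType) (X : choiceType) (L : lieAlgType K)
    (iota : X -> L) (B : set (Br X)) (u : L)
    (alpha : {fsfun Br X -> K with 0}) : Prop :=
  (forall c, c \in finsupp alpha -> B c) /\
  u = \sum_(c <- finsupp alpha) alpha c *: ev iota c.

(* The l^1 norm of the coordinates of [u]. By Viennot's theorem there is exactly
   one such family when [B] is a Hall set and [L] is free over [X], so that the
   value is then finite; the default [+oo] is given to the elements [u], if
   any, that have no coordinates. *)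
Definition Hall_norm (K : numFieldType) (X : choiceType) (L : lieAlgType K)
    (iota : X -> L) (B : set (Br X)) (u : L) : \bar K :=
  xget +oo%E
    [set (\sum_(c <- finsupp alpha) `|alpha c|)%:E
      | alpha in Hall_coords iota B u]%classic.

(* Main.v *)
(* Uniqueness of Hall coordinates. Take a finite set of Hall trees closed under
   subtrees and remove its elements in increasing order. When [h] is removed, the
   trees [ad_h^k c] become the letters of a new alphabet, as in Lazard
   elimination. The universal property passes to this alphabet: a map [g] from it
   to a Lie algebra [N] is realised inside [N[[s]]], extended by the derivation
   [d/ds], by sending [h] to [d/ds] and [c] to
   [\sum_k g (ad_h^k c) s^k / k!] and then evaluating at [s = 0]. Hence a linear
   relation survives each removal, and mapping to an abelian Lie algebra shows
   that the coefficient of the removed tree is zero.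

   The bound. View [[a, b]] as a bracket in the alphabet of those [u >= a] that
   are letters or have a left factor at most [a], keeping [X0] apart as the
   derivation [ad_X0]. The least letter of the alphabet moves onto its sibling
   by the Leibniz rule; each resulting term has one letter fewer and lies in an
   admissible alphabet again. When the letter lands on one of the [p] letters
   different from [X0], [p] decreases, which gives the factor [(p - 1)!]. When it
   lands on an [ad_X0], [p] stays the same and that [ad_X0] disappears; the other
   [ad_X0] it passed on its way then act on one more letter. Giving an [ad_X0]
   acting on [m] letters the weight [4 p^2 2^(p - m)], decreasing in [m], makes
   the terms of the second kind sum to at most a fraction [1 / p] of the total,
   however many [ad_X0] there are. *)

From HB Require Import structures.
Require Import Defs.
From mathcomp Require Import all_boot all_order all_algebra finmap complex.
From mathcomp Require Import boolp classical_sets functions reals constructive_ereal.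
From mathcomp Require Import zify.
Import Order.TTheory GRing.Theory Num.Theory.
Local Open Scope ring_scope.

Set Implicit Arguments.
Unset Strict Implicit.
Unset Printing Implicit Defensive.

(** * Lie algebras of series *)

Section LieTheory.
Variables (K : fieldType) (L : lieAlgType K).
Implicit Types u v w : L.

Lemma lieDl u v w : lie (u + v) w = lie u w + lie v w.
Proof. by have := lie_linearl 1 u v w; rewrite !scale1r. Qed.

Lemma lieDr u v w : lie w (u + v) = lie w u + lie w v.
Proof. by have := lie_linearr 1 u v w; rewrite !scale1r. Qed.

Lemma lie0l w : lie 0 w = 0.
Proof. by apply: (addrI (lie 0 w)); rewrite -lieDl !addr0. Qed.

Lemma lie0r w : lie w 0 = 0.
Proof. by apply: (addrI (lie w 0)); rewrite -lieDr !addr0. Qed.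

Lemma lieZl a u w : lie (a *: u) w = a *: lie u w.
Proof. by have := lie_linearl a u 0 w; rewrite lie0l !addr0. Qed.

Lemma lieZr a u w : lie w (a *: u) = a *: lie w u.
Proof. by have := lie_linearr a u 0 w; rewrite lie0r !addr0. Qed.

Lemma lieNr u w : lie w (- u) = - lie w u.
Proof. by rewrite -scaleN1r lieZr scaleN1r. Qed.

Lemma lieC u v : lie u v = - lie v u.
Proof.
apply/eqP; rewrite -addr_eq0; apply/eqP.
have := lie_alt (u + v).
by rewrite lieDl !lieDr !lie_alt add0r addr0.
Qed.

Lemma lie_sumr (I : Type) (r : seq I) (F : I -> L) w :
  lie w (\sum_(i <- r) F i) = \sum_(i <- r) lie w (F i).
Proof.
elim: r => [|i r IH]; first by rewrite !big_nil lie0r.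
by rewrite !big_cons lieDr IH.
Qed.

Lemma lie_suml (I : Type) (r : seq I) (F : I -> L) w :
  lie (\sum_(i <- r) F i) w = \sum_(i <- r) lie (F i) w.
Proof.
elim: r => [|i r IH]; first by rewrite !big_nil lie0l.
by rewrite !big_cons lieDl IH.
Qed.

Lemma lie_leibniz u v w : lie u (lie v w) = lie (lie u v) w + lie v (lie u w).
Proof.
have := lie_jacobi u v w => /eqP; rewrite -addrA addr_eq0 => /eqP ->.
by rewrite opprD addrC [lie w _]lieC opprK [lie w u]lieC lieNr opprK.
Qed.

End LieTheory.

Definition abelian_lie (K : fieldType) : Type := K^o.
HB.instance Definition _ (K : fieldType) := GRing.Lmodule.on (abelian_lie K).

Section AbelianLie.
Variable K : fieldType.
Let A : lmodType K := abelian_lie K.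
Let bracket (u v : A) : A := 0.

Fact abelian_linear (a : K) (u v w : A) :
  bracket (a *: u + v) w = a *: bracket u w + bracket v w.
Proof. by rewrite /bracket scaler0 addr0. Qed.

Fact abelian_jacobi (u v w : A) :
  bracket u (bracket v w) + bracket v (bracket w u) + bracket w (bracket u v)
  = 0.
Proof. by rewrite /bracket !addr0. Qed.

HB.instance Definition _ := @isLieAlgebra.Build K (abelian_lie K) bracket
  abelian_linear abelian_linear (fun=> erefl) abelian_jacobi.

End AbelianLie.

(* The sequence [f] stands for the series [\sum_n f n s^n / n!], so that the
   derivative is the shift; this encoding avoids dividing by [n!]. *)
Definition lie_series (K : fieldType) (N : lieAlgType K) : Type := nat -> N.
HB.instance Definition _ (K : fieldType) (N : lieAlgType K) :=
  GRing.Lmodule.copy (lie_series N) (nat -> N).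

Definition shift (K : fieldType) (N : lieAlgType K) (f : lie_series N) :
  lie_series N := fun n => f n.+1.

Arguments shift : simpl never.

Section LieSeries.
Variables (K : fieldType) (N : lieAlgType K).
Implicit Types f g h : lie_series N.

Fact shift_linear : linear (@shift K N).
Proof. by []. Qed.

HB.instance Definition _ :=
  GRing.isLinear.Build K (lie_series N) (lie_series N) _ (@shift K N)
    shift_linear.

(** The bracket of two exponential series, whose coefficients are binomial convolutions. Taking the
    Leibniz rule as the recursion makes [shift] a derivation by definition and avoids binomial
    coefficients. *)
Fixpoint conv f g n : N :=
  if n is m.+1 then conv (shift f) g m + conv f (shift g) m
  else lie (f 0) (g 0).

Lemma conv_linearl (a : K) f g h :
  (conv (a *: f + g) h : lie_series N) = a *: (conv f h : lie_series N) + conv g h.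
Proof.
apply/funext => n; rewrite /GRing.add /GRing.scale /=.
elim: n f g h => [|n IH] f g h /=; first exact: lie_linearl.
by rewrite !linearP !IH scalerDr addrACA.
Qed.

Lemma conv_linearr (a : K) f g h :
  (conv h (a *: f + g) : lie_series N) = a *: (conv h f : lie_series N) + conv h g.
Proof.
apply/funext => n; rewrite /GRing.add /GRing.scale /=.
elim: n f g h => [|n IH] f g h /=; first exact: lie_linearr.
by rewrite !linearP !IH scalerDr addrACA.
Qed.

Lemma conv_antisym f g n : conv f g n = - conv g f n.
Proof.
elim: n f g => [|n IH] f g /=; first exact: lieC.
by rewrite IH [conv f _ n]IH -opprD addrC.
Qed.

Lemma conv_alt f : (conv f f : lie_series N) = 0.
Proof.
apply/funext => -[|n] /=; first exact: lie_alt.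
by rewrite conv_antisym addNr.
Qed.

Lemma convDr f g h n :
  conv f ((g : lie_series N) + h) n = conv f g n + conv f h n.
Proof.
by have := conv_linearr 1 g h f; rewrite !scale1r => ->.
Qed.

(** The derivative of a Jacobi sum is the sum of the three Jacobi sums in which one argument is
    differentiated; hence the induction on the coefficient. *)
Lemma conv_jacobi f g h :
  (conv f (conv g h) : lie_series N) + conv g (conv h f) + conv h (conv f g)
  = 0.
Proof.
apply/funext => n; change (conv f (conv g h) n + conv g (conv h f) n +
  conv h (conv f g) n = 0).
elim: n f g h => [|n IH] f g h /=; first exact: lie_jacobi.
have shift_conv f1 f2 : shift (conv f1 f2) =
  (conv (shift f1) f2 : lie_series N) + conv f1 (shift f2) by [].
rewrite !shift_conv !convDr.
have := congr2 +%R (IH (shift f) g h)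
  (congr2 +%R (IH f (shift g) h) (IH f g (shift h))).
rewrite !addr0 => <-.
by rewrite [LHS](AC ((1*2)*(1*2)*(1*2)) ((1*6*8)*((2*4*9)*(3*5*7)))).
Qed.

HB.instance Definition _ := @isLieAlgebra.Build K (lie_series N) conv
  conv_linearl conv_linearr conv_alt conv_jacobi.

End LieSeries.

(** This is the first component of the Jacobi identity for [(f, a)], [(g, b)], [(h, c)] in the
    semidirect product of [A] with the line spanned by [d]. After expansion the terms in [d] cancel
    in pairs. *)
Lemma derivation_jacobi (K : fieldType) (A : lieAlgType K)
    (d : {linear A -> A}) (a b c : K) (f g h : A) :
    (forall u v : A, d (lie u v) = lie (d u) v + lie u (d v)) ->
  (lie f (lie g h + (b *: d h - c *: d g))
     + a *: d (lie g h + (b *: d h - c *: d g)))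
  + (lie g (lie h f + (c *: d f - a *: d h))
     + b *: d (lie h f + (c *: d f - a *: d h)))
  + (lie h (lie f g + (a *: d g - b *: d f))
     + c *: d (lie f g + (a *: d g - b *: d f))) = 0.
Proof.
move=> d_lie; rewrite !(linearD d) !(linearN d) !(linearZ_LR d) !d_lie.
rewrite !lieDr !lieNr !lieZr !scalerDr.
rewrite [lie (d g) h]lieC [lie (d h) f]lieC [lie (d f) g]lieC.
rewrite !scalerN !scalerA [b * a]mulrC [c * b]mulrC [c * a]mulrC.
rewrite [LHS](AC (((1*2)*(2*2))*((1*2)*(2*2))*((1*2)*(2*2)))
  ((1*8*15)*(2*11)*(16*4)*(9*18)*(19*3)*(5*10)*(12*17)*(6*14)*(13*21)*(20*7))).
by rewrite /= lie_jacobi !subrr !addr0.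
Qed.

(* The semidirect product of [lie_series N] with the line spanned by [d/ds]. *)
Definition drift (K : fieldType) (N : lieAlgType K) : Type :=
  (lie_series N * K^o)%type.
HB.instance Definition _ (K : fieldType) (N : lieAlgType K) :=
  GRing.Lmodule.copy (drift N) (lie_series N * K^o)%type.

Section Drift.
Variables (K : fieldType) (N : lieAlgType K).
Implicit Types u v w : drift N.

Definition drift_bracket u v : drift N :=
  (lie u.1 v.1 + ((u.2 : K) *: shift v.1 - (v.2 : K) *: shift u.1), 0).

Lemma drift_antisym u v : drift_bracket u v = - drift_bracket v u.
Proof.
congr (_, _); rewrite ?oppr0 //=.
by rewrite opprD opprB -lieC.
Qed.

Lemma drift_linearr (a : K) u v w :
  drift_bracket w (a *: u + v) = a *: drift_bracket w u + drift_bracket w v.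
Proof.
case: u v w => [f x] [g y] [h z]; congr (_, _) => /=; last first.
  by rewrite scaler0 addr0.
rewrite lie_linearr.
have -> : shift (a *: f + g) = a *: shift f + shift g by [].
have -> : (a *: (x : K^o) + y : K) = a * x + y by [].
rewrite scalerDl !scalerDr scalerN !scalerA [z * a]mulrC opprD.
by rewrite [LHS](AC (2*(2*2)) ((1*(3*5))*(2*(4*6)))).
Qed.

Lemma drift_linearl (a : K) u v w :
  drift_bracket (a *: u + v) w = a *: drift_bracket u w + drift_bracket v w.
Proof.
by rewrite drift_antisym drift_linearr opprD -scalerN -!drift_antisym.
Qed.

Lemma drift_alt u : drift_bracket u u = 0.
Proof. by congr (_, _); rewrite lie_alt subrr addr0. Qed.

Lemma drift_jacobi u v w :
  drift_bracket u (drift_bracket v w) + drift_bracket v (drift_bracket w u) +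
  drift_bracket w (drift_bracket u v) = 0.
Proof.
case: u v w => [f a] [g b] [h c]; congr (_, _); rewrite /= ?addr0 //.
rewrite !scale0r !subr0.
(* That [shift] is a derivation holds by conversion. *)
exact: (@derivation_jacobi K (lie_series N) (@shift K N)).
Qed.

HB.instance Definition _ := @isLieAlgebra.Build K (drift N) drift_bracket
  drift_linearl drift_linearr drift_alt drift_jacobi.

Lemma lie_driftE u v :
  lie u v = (lie u.1 v.1 + ((u.2 : K) *: shift v.1 - (v.2 : K) *: shift u.1), 0).
Proof. by []. Qed.

End Drift.

(** * Linear independence of Hall trees *)

Section HallOrder.
Variables (X : choiceType) (B : set (Br X)) (lt : Br X -> Br X -> Prop).
Hypothesis hallB : is_Hall_set B lt.
Implicit Types (b c t u v : Br X) (l s : seq (Br X)).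

Lemma Hall_lt_neq u v : B u -> lt u v -> v != u.
Proof. by move=> Bu ltuv; apply: contra_not_neq (Hall_irr hallB Bu) => {2}<-. Qed.

Lemma Hall_min l : {in l, forall c, B c} -> l != [::] ->
  exists2 h, h \in l & {in l, forall c, c != h -> lt h c}.
Proof.
elim: l => // c [|d l] IH Bl _.
  by exists c; rewrite ?mem_head // => e; rewrite inE => ->.
have [| |h hl hmin] := IH; first by move=> e el; apply: Bl; rewrite inE el orbT.
  by [].
have [Bc Bh] : B c /\ B h by split; apply: Bl; rewrite inE ?eqxx ?hl ?orbT.
case: (Hall_total hallB Bc Bh) => [lt_ch|eq_ch|lt_hc].
- exists c; rewrite ?mem_head // => e; rewrite inE => /predU1P[->|el neq].
    by rewrite eqxx.
  have [->//|neh] := eqVneq e h.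
  apply: (Hall_trans hallB _ Bh _ lt_ch) => //; last exact: hmin.
  by apply: Bl; rewrite inE el orbT.
- exists h; first by rewrite inE hl orbT.
  by move=> e; rewrite inE => /predU1P[->|/hmin//]; rewrite eq_ch eqxx.
- exists h; first by rewrite inE hl orbT.
  by move=> e; rewrite inE => /predU1P[->//|/hmin].
Qed.

Lemma Hall_lt_node_l c1 c2 : B (node c1 c2) -> lt c1 (node c1 c2).
Proof.
move=> Bc; have [] := (Hall_node hallB c1 c2).1 Bc => B1 B2 _ _.
exact: (Hall_lt_node hallB).
Qed.

(** Closure under both factors would not survive the removal of the least tree: it may be the left
    factor of a remaining tree, which then becomes a letter. *)
Definition Hall_segment l := [/\ uniq l, {in l, forall c, B c} &
  forall c1 c2, node c1 c2 \in l -> c1 \in l -> c2 \in l].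

(** A right factor is greater than its left factor, which is greater than [h] if it remains; so the
    right factor is not the tree removed. *)
Lemma Hall_segment_rem l h : Hall_segment l -> h \in l ->
  {in l, forall c, c != h -> lt h c} -> Hall_segment (rem h l).
Proof.
move=> [Ul Bl closed_l] hl hmin.
split=> [|c|c1 c2]; rewrite ?rem_uniq // !mem_rem_uniq // !inE.
  by case/andP=> _ /Bl.
case/andP=> _ c_l /andP[c1h c1l]; have c2l := closed_l _ _ c_l c1l.
have [B1 B2 lt12 _] := (Hall_node hallB c1 c2).1 (Bl _ c_l).
rewrite c2l andbT; apply: (Hall_lt_neq (Bl _ hl)).
exact: (Hall_trans hallB (Bl _ hl) B1 B2 (hmin _ c1l c1h) lt12).
Qed.

End HallOrder.

(* Evaluation of a tree of [l] as a bracket in the alphabet of those [t] in [l]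
   that are letters or have their left factor outside [l]. *)
Fixpoint evl (X : choiceType) (K : fieldType) (N : lieAlgType K)
    (l : seq (Br X)) (g : Br X -> N) (t : Br X) : N :=
  if t is node t1 t2 then
    if t1 \in l then lie (evl l g t1) (evl l g t2) else g t
  else g t.

Section Independence.
Variables (X : choiceType) (B : set (Br X)) (lt : Br X -> Br X -> Prop).
Hypothesis hallB : is_Hall_set B lt.
Variable K : fieldType.
Implicit Types (b c h t u v : Br X) (l s : seq (Br X)) (al : Br X -> K).

(** Quantifying over all targets expresses a relation in the free Lie algebra over the alphabet of
    [l] without constructing that algebra. *)
Definition dependency l al := forall (N : lieAlgType K) (g : Br X -> N),
  \sum_(c <- l) al c *: evl l g c = 0.

Definition drift_letter (N : lieAlgType K) (g : Br X -> N) h c : drift N :=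
  if c == h then (0, 1) else (fun k => g (iter k (node h) c), 0).

(** * Removal of the least tree *)

Section Elimination.
Variables (l : seq (Br X)) (h : Br X).
Hypotheses (segl : Hall_segment B l) (hl : h \in l).
Hypothesis hmin : {in l, forall c, c != h -> lt h c}.

Let Bl c : c \in l -> B c. Proof. by case: segl => _ + _; apply. Qed.

Let mem_rem c : (c \in rem h l) = (c != h) && (c \in l).
Proof. by case: segl => Ul _ _; rewrite mem_rem_uniq // inE. Qed.

(** The left factor of [h] would be less than [h], so it is not in [l] and [h] is a letter. *)
Lemma evl_min (N : lieAlgType K) (g : Br X -> N) : evl l g h = g h.
Proof.
case h_eq: h => [//|h1 h2] /=; case: ifP => // h1l.
have Bh := Bl hl; rewrite h_eq in Bh.
have lt1h := Hall_lt_node_l hallB Bh.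
case: (Hall_irr hallB Bh); apply: (Hall_trans hallB _ _ _ _ lt1h) => //.
  exact: Bl.
rewrite -h_eq; apply: hmin => //.
by rewrite eq_sym h_eq (Hall_lt_neq hallB _ lt1h) //; apply: Bl.
Qed.

(** Only the value at [s = 0] is used later. The induction needs the whole series for letters of the
    new alphabet, because bracketing with [h] differentiates. *)
Lemma evl_drift (N : lieAlgType K) (g : Br X -> N) c : c \in rem h l ->
  [/\ (evl l (drift_letter g h) c).2 = 0,
      (evl l (drift_letter g h) c).1 0 = evl (rem h l) g c &
      (if c is node c1 _ then c1 \notin rem h l else true) ->
      (evl l (drift_letter g h) c).1 = fun k => g (iter k (node h) c)].
Proof.
elim: c => [x|c1 IH1 c2 IH2]; rewrite mem_rem => /andP[ch cl].
  by rewrite /= /drift_letter (negbTE ch).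
have [B1 B2 lt12 left2] := (Hall_node hallB c1 c2).1 (Bl cl).
have c2_rem : c1 \in l -> c2 \in rem h l.
  move=> c1l; have c2l : c2 \in l by case: segl => _ _ l_node; apply: l_node cl c1l.
  rewrite mem_rem c2l andbT; apply: (Hall_lt_neq hallB (Bl hl)).
  have [<-//|c1h] := eqVneq c1 h.
  by apply: (Hall_trans hallB _ B1 _ (hmin c1l c1h)) => //; apply: Bl.
rewrite [evl l _ _]/=; case: ifP => c1l; last first.
  have c1r : c1 \notin rem h l by rewrite mem_rem c1l andbF.
  by rewrite /drift_letter (negbTE ch) /= (negbTE c1r).
have c2r := c2_rem c1l; have [z2 e2 f2] := IH2 c2r.
have [c1h|c1h] := eqVneq c1 h.
  have c1r : c1 \notin rem h l by rewrite mem_rem c1h eqxx.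
  have e1 : evl l (drift_letter g h) c1 = (0, 1).
    by rewrite c1h evl_min /drift_letter eqxx.
  (* [c2] is a letter of the new alphabet: by the Hall condition its left factor is at most
     [c1 = h], while all remaining trees are greater than [h]. *)
  have f2' : (evl l (drift_letter g h) c2).1 = fun k => g (iter k (node h) c2).
    apply: f2; case: (c2) left2 B2 => // d1 d2 left2 B2.
    have [Bd _ _ _] := (Hall_node hallB d1 d2).1 B2.
    rewrite mem_rem; apply/andP => -[d1h d1l]; have lt_hd := hmin d1l d1h.
    case: left2 => [ltd|eqd]; last by rewrite eqd c1h eqxx in d1h.
    apply: (Hall_irr hallB Bd); apply: (Hall_trans hallB Bd B1 Bd ltd).
    by rewrite c1h.
  (* Bracketing with [d/ds] shifts the sequence of the [ad_h^k c2], which gives the sequence of the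
     [ad_h^k (node h c2)]. *)
  have E : (lie (evl l (drift_letter g h) c1) (evl l (drift_letter g h) c2)).1
      = fun k => g (iter k (node h) (node c1 c2)).
    rewrite lie_driftE e1 z2 /= scale1r scale0r subr0 lie0l add0r f2' c1h.
    by apply/funext => k; rewrite /shift iterSr.
  by split; rewrite ?E // [RHS]/= (negbTE c1r).
have c1r : c1 \in rem h l by rewrite mem_rem c1h.
have [z1 e1 _] := IH1 c1r.
split=> //=; last by rewrite c1r.
rewrite c1r z1 z2 /= !scale0r subr0 addr0 -e1 -e2.
by [].
Qed.

Lemma dependency_min al : dependency l al -> al h = 0.
Proof.
move=> dep; have Ul : uniq l by case: segl.
(* With the indicator of [h], all brackets and all letters other than [h] evaluate to zero. *)
have := dep (abelian_lie K) (fun c => (c == h)%:R).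
rewrite (bigD1_seq h) //= evl_min eqxx big1_seq ?addr0 => [|c /andP[ch cl]].
  by rewrite /GRing.scale /= mulr1.
suff -> : evl l (fun c => (c == h)%:R : abelian_lie K) c = 0 by rewrite scaler0.
by case: c ch cl => [x|c1 c2] /= /negbTE-> // _; case: ifP.
Qed.

Lemma dependency_rem al : dependency l al -> dependency (rem h l) al.
Proof.
move=> dep N g; have Ul : uniq l by case: segl.
have := dep (drift N) (drift_letter g h).
rewrite (bigD1_seq h) //= dependency_min // scale0r add0r => eq0.
have {}eq0 : (\sum_(c <- rem h l) al c *: evl l (drift_letter g h) c) = 0.
  by rewrite rem_filter // big_filter.
have sum1 (r : seq (Br X)) (F : Br X -> drift N) :
    (\sum_(i <- r) F i).1 0 = \sum_(i <- r) (F i).1 0.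
  by elim: r => [|i r IH]; rewrite ?big_nil // !big_cons -IH.
transitivity ((0 : drift N).1 0) => //; rewrite -eq0 sum1.
rewrite big_seq [RHS]big_seq.
by apply: eq_bigr => c cl; have [_ <- _] := evl_drift g cl.
Qed.

End Elimination.

Lemma dependency_trivial l al : Hall_segment B l -> dependency l al ->
  {in l, forall c, al c = 0}.
Proof.
move: {2}(size l) (erefl (size l)) => n.
elim: n l => [|n IH] l size_l segl dep c cl; first by rewrite (size0nil size_l) in cl.
have [Ul Bl _] := segl.
have l0 : l != [::] by rewrite -size_eq0 size_l.
have [h hl hmin] := Hall_min hallB Bl l0.
have al0 := dependency_min segl hl hmin dep.
have [->//|ch] := eqVneq c h.
apply: (IH (rem h l)).
- by rewrite size_rem // size_l.
- exact: Hall_segment_rem hmin.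
- exact: dependency_rem.
- by rewrite mem_rem_uniq // inE ch.
Qed.

(** * Independence in the free Lie algebra *)

Fixpoint subtrees (t : Br X) : seq (Br X) :=
  t :: (if t is node t1 t2 then subtrees t1 ++ subtrees t2 else [::]).

Lemma subtrees_refl t : t \in subtrees t.
Proof. by case: t => *; rewrite mem_head. Qed.

Lemma subtrees_node t t1 t2 : node t1 t2 \in subtrees t ->
  t1 \in subtrees t /\ t2 \in subtrees t.
Proof.
elim: t => [x|u1 IH1 u2 IH2] /=; first by rewrite inE.
rewrite !inE !mem_cat => /predU1P[[-> ->]|/orP[/IH1|/IH2] [-> ->]].
- by rewrite !subtrees_refl !orbT.
- by rewrite !orbT.
- by rewrite !orbT.
Qed.

Lemma subtrees_Hall t : B t -> {in subtrees t, forall c, B c}.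
Proof.
elim: t => [x|u1 IH1 u2 IH2] Bt c /=; first by rewrite inE => /eqP->.
have [B1 B2 _ _] := (Hall_node hallB u1 u2).1 Bt.
by rewrite !inE mem_cat => /predU1P[->|/orP[/(IH1 B1)|/(IH2 B2)]].
Qed.

Variables (L : lieAlgType K) (iota : X -> L).
Hypothesis freeL : is_free_lie iota.

Lemma Hall_independent s al : uniq s -> {in s, forall c, B c} ->
  \sum_(c <- s) al c *: ev iota c = 0 -> {in s, forall c, al c = 0}.
Proof.
move=> Us Bs eq0 c cs.
(* In a set closed under both factors the alphabet consists of leaves only, so [evl] is the image of
   [ev] under a morphism from the free Lie algebra. *)
pose l := undup (flatten (map subtrees s)).
have lP d : reflect (exists2 t, t \in s & d \in subtrees t) (d \in l).
  by rewrite mem_undup; apply: flatten_mapP.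
have l_node c1 c2 : node c1 c2 \in l -> c1 \in l /\ c2 \in l.
  by case/lP=> t ts /subtrees_node[? ?]; split; apply/lP; exists t.
have segl : Hall_segment B l.
  split=> [|d /lP[t /Bs Bt]|c1 c2 /l_node[]//]; first exact: undup_uniq.
  exact: subtrees_Hall.
have sl : {subset s <= l}.
  by move=> t ts; apply/lP; exists t => //; apply: subtrees_refl.
pose be d := if d \in s then al d else 0.
suff /dependency_trivial/(_ c (sl _ cs)) : dependency l be by rewrite /be cs; apply.
move=> N g; have [phi [phi_lie phi_iota _]] := freeL (fun x => g (leaf x)).
have evlE d : d \in l -> evl l g d = phi (ev iota d).
  elim: d => [x|c1 IH1 c2 IH2] /=; first by rewrite phi_iota.
  by case/l_node=> c1l c2l; rewrite c1l IH1 // IH2 // phi_lie.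
transitivity (phi (\sum_(c <- s) al c *: ev iota c)); last by rewrite eq0 linear0.
rewrite linear_sum /=.
rewrite (bigID (mem s)) /= [X in _ + X]big1 ?addr0 => [|d /negbTE ds]; last first.
  by rewrite /be ds scale0r.
rewrite -big_filter (perm_big s) /=; last first.
  apply: uniq_perm; rewrite ?filter_uniq ?undup_uniq // => d.
  by rewrite mem_filter andb_idr //; apply: sl.
rewrite big_seq [RHS]big_seq; apply: eq_bigr => d ds.
by rewrite /be ds linearZ evlE //; apply: sl.
Qed.

End Independence.

(** * Brackets over an alphabet *)

(* The root of [Der s] is a bracket with the distinguished letter [X0], up to
   sign. *)
Inductive dtree (X : Type) : Type :=
| Leaf of Br X
| Der of dtree X
| Bin of dtree X & dtree X.

Section DtreeEq.
Variable X : choiceType.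

Fixpoint dtree_encode (t : dtree X) : GenTree.tree (Br X) :=
  match t with
  | Leaf h => GenTree.Leaf h
  | Der s => GenTree.Node 0 [:: dtree_encode s]
  | Bin s t => GenTree.Node 0 [:: dtree_encode s; dtree_encode t]
  end.

Fixpoint dtree_decode (t : GenTree.tree (Br X)) : option (dtree X) :=
  match t with
  | GenTree.Leaf h => Some (Leaf h)
  | GenTree.Node _ [:: s] => omap (@Der X) (dtree_decode s)
  | GenTree.Node _ [:: s; t] =>
      if (dtree_decode s, dtree_decode t) is (Some s', Some t')
      then Some (Bin s' t') else None
  | _ => None
  end.

Lemma dtree_encodeK : pcancel dtree_encode dtree_decode.
Proof. by elim=> //= [s ->|s -> t ->]. Qed.

HB.instance Definition _ := Equality.copy (dtree X) (pcan_type dtree_encodeK).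

End DtreeEq.

Section Weights.
Local Open Scope nat_scope.
Variables (X : choiceType) (X0 : X).
Implicit Types (a b c h u v : Br X) (r s t : dtree X).

Fixpoint nleaf t : nat :=
  match t with
  | Leaf _ => 1
  | Der s => nleaf s
  | Bin s t => nleaf s + nleaf t
  end.

Fixpoint nder t : nat :=
  match t with
  | Leaf _ => 0
  | Der s => (nder s).+1
  | Bin s t => nder s + nder t
  end.

Fixpoint dleaves t : seq (Br X) :=
  match t with
  | Leaf h => [:: h]
  | Der s => dleaves s
  | Bin s t => dleaves s ++ dleaves t
  end.

(** Each derivation contributes [leaf X0], since [X0] takes part in the choice of the least
    letter. *)
Fixpoint letters t : seq (Br X) :=
  match t with
  | Leaf h => [:: h]
  | Der s => leaf X0 :: letters s
  | Bin s t => letters s ++ letters t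
  end.

Definition wt n m := 4 * n ^ 2 * 2 ^ (n - m).

(** The parameter [n] stands for the number of leaves of the whole tree, so that subtrees are
    weighed relative to it. *)
Fixpoint weight n t : nat :=
  match t with
  | Leaf _ => 1
  | Der s => wt n (nleaf s) * weight n s
  | Bin s t => weight n s * weight n t
  end.

(* [absorb a t] and [cross a t] list the terms of the expansion of [[a, t]] by the
   Leibniz rule in which [a] lands on a leaf, respectively on an [ad_X0]. *)
Fixpoint absorb a t : seq (dtree X) :=
  match t with
  | Leaf u => if u == a then [::] else [:: Leaf (node a u)]
  | Der s => map (@Der X) (absorb a s)
  | Bin s t => map (@Bin X ^~ t) (absorb a s) ++ map (Bin s) (absorb a t)
  end.

Fixpoint cross a t : seq (dtree X) :=
  match t with
  | Leaf _ => [::]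
  | Der s => Bin (Leaf (node a (leaf X0))) s :: map (@Der X) (cross a s)
  | Bin s t => map (@Bin X ^~ t) (cross a s) ++ map (Bin s) (cross a t)
  end.

Definition is_leaf a t := if t is Leaf u then u == a else false.

(* The same terms when one occurrence of the leaf [a] in [t] is pushed onto its
   sibling. *)
Fixpoint red_absorb a t : seq (dtree X) :=
  match t with
  | Leaf _ => [::]
  | Der s => map (@Der X) (red_absorb a s)
  | Bin s t =>
      if is_leaf a s then absorb a t else
      if is_leaf a t then absorb a s else
      if a \in dleaves s then map (@Bin X ^~ t) (red_absorb a s)
      else map (Bin s) (red_absorb a t)
  end.

Fixpoint red_cross a t : seq (dtree X) :=
  match t with
  | Leaf _ => [::]
  | Der s => if is_leaf a s then [:: Leaf (node a (leaf X0))]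
             else map (@Der X) (red_cross a s)
  | Bin s t =>
      if is_leaf a s then cross a t else
      if is_leaf a t then cross a s else
      if a \in dleaves s then map (@Bin X ^~ t) (red_cross a s)
      else map (Bin s) (red_cross a t)
  end.

(* The terms obtained by pushing one occurrence of [ad_X0] down to the leaves. *)
Fixpoint red_der t : seq (dtree X) :=
  match t with
  | Leaf _ => [::]
  | Der s => absorb (leaf X0) s
  | Bin s t =>
      if 0 < nder s then map (@Bin X ^~ t) (red_der s)
      else map (Bin s) (red_der t)
  end.

(** The letter [a] is kept, as it may have other occurrences in the bracket. *)
Definition extend a (l : seq (Br X)) :=
  l ++ [seq node a u | u <- l & u != a].

(** * Counting and weighing the terms *)

Lemma nleaf_gt0 t : 0 < nleaf t.
Proof. by elim: t => //= s Hs t _; rewrite addn_gt0 Hs. Qed.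

Lemma wt_half n m : m < n -> wt n m = 2 * wt n m.+1.
Proof. by move=> ltmn; rewrite /wt -(subnSK ltmn) (expnS 2) mulnCA. Qed.

Lemma wt_ge n m : 4 * n ^ 2 <= wt n m.
Proof. by rewrite leq_pmulr // expn_gt0. Qed.

Lemma wt_le n m : wt n m <= 4 * n ^ 2 * 2 ^ n.
Proof. by rewrite leq_mul2l leq_exp2l // leq_subr orbT. Qed.

(** When one of [n.+1] letters disappears, an [ad_X0] loses at most one of the letters it acts on,
    so the power of 2 does not grow. The square factor then yields at least the ratio [n / n.+1]. *)
Lemma wt_pred n m k : m <= k.+1 -> n.+1 * wt n k <= n * wt n.+1 m.
Proof.
move=> lemk; rewrite /wt.
have : 2 ^ (n - k) <= 2 ^ (n.+1 - m) by rewrite leq_exp2l //; lia.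
move: (2 ^ _) (2 ^ _) => A C leAC.
have : n.+1 * (4 * n ^ 2) <= n * (4 * n.+1 ^ 2) by nia.
by move=> le; rewrite !mulnA leq_mul // -!mulnA.
Qed.

Lemma weight_le n t : weight n t <= (4 * n ^ 2 * 2 ^ n) ^ nder t.
Proof.
elim: t => //= [s IH|s IHs t IHt]; first by rewrite expnS leq_mul // wt_le.
by rewrite expnD leq_mul.
Qed.

Lemma weight_pred n t : n.+1 ^ nder t * weight n t <= n ^ nder t * weight n.+1 t.
Proof.
elim: t => //= [s IH|s IHs t IHt].
  rewrite !expnS mulnACA [leqRHS]mulnACA leq_mul //.
  exact: wt_pred.
by rewrite !expnD mulnACA [leqRHS]mulnACA leq_mul.
Qed.

Lemma extendS a (l1 l2 : seq (Br X)) :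
  {subset l1 <= l2} -> {subset extend a l1 <= extend a l2}.
Proof.
move=> sub12 c; rewrite !mem_cat => /orP[/sub12->//|/mapP[u]].
rewrite mem_filter => /andP[ua /sub12 ul] ->.
by apply/orP; right; apply/mapP; exists u; rewrite // mem_filter ua.
Qed.

Lemma extend_sub a (l : seq (Br X)) : {subset l <= extend a l}.
Proof. by move=> c cl; rewrite mem_cat cl. Qed.

Lemma extend_cat a (l1 l2 : seq (Br X)) :
  {subset extend a l1 ++ extend a l2 <= extend a (l1 ++ l2)}.
Proof.
move=> c; rewrite mem_cat => /orP[]; apply: extendS => d dl.
  by rewrite mem_cat dl.
by rewrite mem_cat dl orbT.
Qed.

Lemma extend_catl a (l l1 l2 : seq (Br X)) :
  {subset l <= extend a l1} -> {subset l ++ l2 <= extend a (l1 ++ l2)}.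
Proof.
move=> sub c; rewrite mem_cat => /orP[/sub cl|cl]; apply: extend_cat.
  by rewrite mem_cat cl.
by rewrite mem_cat (extend_sub _ cl) orbT.
Qed.

Lemma extend_catr a (l l1 l2 : seq (Br X)) :
  {subset l <= extend a l2} -> {subset l1 ++ l <= extend a (l1 ++ l2)}.
Proof.
move=> sub c; rewrite mem_cat => /orP[cl|/sub cl]; apply: extend_cat.
  by rewrite mem_cat (extend_sub _ cl).
by rewrite mem_cat cl orbT.
Qed.

Lemma extend_cons a c (l1 l2 : seq (Br X)) :
  {subset l1 <= extend a l2} -> {subset c :: l1 <= extend a (c :: l2)}.
Proof. exact: (@extend_catr a l1 [:: c] l2). Qed.

Lemma absorbP a t r : r \in absorb a t ->
  [/\ nleaf r = nleaf t, nder r = nder t, forall n, weight n r = weight n t &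
      {subset letters r <= extend a (letters t)}].
Proof.
elim: t r => [u|s IH|s IHs t IHt] r /=.
- case: eqVneq => // ua; rewrite inE => /eqP->; split=> // c.
  by rewrite /extend /= ua !inE => ->; rewrite orbT.
- case/mapP=> {}r /IH[nl nd w sub] -> /=; rewrite nl nd; split=> // [n|].
    by rewrite w.
  exact: extend_cons.
- rewrite mem_cat => /orP[] /mapP[{}r /[dup] r_in + ->] /=.
    case/IHs=> nl nd w sub; rewrite nl nd; split=> // [n|]; first by rewrite w.
    exact: extend_catl.
  case/IHt=> nl nd w sub; rewrite nl nd; split=> // [n|]; first by rewrite w.
  exact: extend_catr.
Qed.

Lemma size_absorb a t : size (absorb a t) <= nleaf t.
Proof.
elim: t => [u|s IH|s IHs t IHt] /=; first by case: ifP.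
  by rewrite size_map.
by rewrite size_cat !size_map leq_add.
Qed.

(** The [X0] of the lost derivation enters the new letter [node a (leaf X0)], which [extend]
    supplies when [a] is not [leaf X0]. *)
Lemma crossP a t r : r \in cross a t ->
  [/\ nleaf r = (nleaf t).+1, (nder r).+1 = nder t &
      a != leaf X0 -> {subset letters r <= extend a (letters t)}].
Proof.
elim: t r => [u|s IH|s IHs t IHt] r //=.
- rewrite inE => /predU1P[->|/mapP[{}r /IH[nl nd sub] ->]] /=; last first.
    by rewrite nl nd; split=> // /sub; apply: extend_cons.
  split=> // aX0 c; rewrite inE => /predU1P[->|cs].
    by rewrite mem_cat /= eq_sym aX0 mem_head orbT.
  by apply: extend_sub; rewrite inE cs orbT.
- rewrite mem_cat => /orP[] /mapP[{}r r_in ->] /=.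
    have [nl nd sub] := IHs _ r_in; rewrite nl -nd; split=> // /sub.
    exact: extend_catl.
  have [nl nd sub] := IHt _ r_in; rewrite nl -nd addnS; split=> //.
    by rewrite addnS.
  by move=> /sub; apply: extend_catr.
Qed.

(** Each [ad_X0] passed acts on one more letter, so its weight is halved; the one hit disappears,
    which saves a factor of at least [4 n^2]. Along nested derivations this gives a geometric sum,
    bounded independently of their number. *)
Lemma weight_cross a t n : nleaf t < n ->
  4 * n ^ 2 * (\sum_(r <- cross a t) weight n r) <= 2 * nleaf t * weight n t.
Proof.
(* Here [v] is [4 n^2], [2 * w] and [w] are the weights of the root derivation before and after it
   gains a letter, and [W] and [S] are the weights of its argument and of the cross terms of that
   argument. *)
have aux (S v w W m : nat) : v * S <= 2 * m * W -> 0 < m -> v <= w ->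
    v * (W + w * S) <= 2 * m * (2 * w * W).
  move=> le1 m_gt0 le_vw.
  have le2 : w * (v * S) <= w * (2 * m * W) by rewrite leq_mul2l le1 orbT.
  have le3 : v * W <= w * W by rewrite leq_mul2r le_vw orbT.
  have le4 : w * W <= m * (w * W) by rewrite leq_pmull.
  rewrite mulnDr; nia.
elim: t => [u|s IH|s IHs t IHt] /= lt_n; first by rewrite big_nil muln0.
- rewrite big_cons /= mul1n big_map /=.
  have -> : \sum_(r <- cross a s) wt n (nleaf r) * weight n r =
      wt n (nleaf s).+1 * \sum_(r <- cross a s) weight n r.
    rewrite big_distrr /= big_seq [RHS]big_seq.
    by apply: eq_bigr => r /crossP[-> _ _].
  rewrite (wt_half lt_n); apply: aux; first exact: IH.
    exact: nleaf_gt0.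
  exact: wt_ge.
- have {}IHs : 4 * n ^ 2 * \sum_(r <- cross a s) weight n r <= 2 * nleaf s * weight n s.
    by apply: IHs; apply: leq_ltn_trans lt_n; rewrite leq_addr.
  have {}IHt : 4 * n ^ 2 * \sum_(r <- cross a t) weight n r <= 2 * nleaf t * weight n t.
    by apply: IHt; apply: leq_ltn_trans lt_n; rewrite leq_addl.
  rewrite big_cat !big_map /= -big_distrl -big_distrr /= mulnDr mulnDr mulnDl.
  apply: leq_add; first by rewrite mulnA [leqRHS]mulnA leq_mul2r IHs orbT.
  by rewrite mulnCA [leqRHS]mulnCA leq_mul2l IHt orbT.
Qed.

Lemma is_leafP a t : reflect (t = Leaf a) (is_leaf a t).
Proof.
by case: t => [u||] /=; try (by constructor); apply: (iffP eqP) => [->|[]].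
Qed.

Lemma red_absorbP a t r : a \in dleaves t -> r \in red_absorb a t ->
  [/\ (nleaf r).+1 = nleaf t, nder r = nder t,
      forall n, n.+1 ^ nder t * weight n r <= n ^ nder t * weight n.+1 t &
      {subset letters r <= extend a (letters t)}].
Proof.
elim: t r => [u|s IH|s IHs t IHt] r //=.
- move=> a_s /mapP[{}r /(IH _ a_s)[nl nd w sub] ->] /=; rewrite nd.
  split=> // [n|]; last exact: extend_cons.
  rewrite !expnS mulnACA [leqRHS]mulnACA leq_mul //.
  by rewrite wt_pred // -nl.
- rewrite mem_cat => a_st; case: is_leafP => [->|sNa].
    move/absorbP => [nl nd w sub] /=; rewrite nl nd; split=> // [n|].
      by rewrite w mul1n weight_pred.
    by move=> c /sub; apply: extendS => d dt; rewrite inE dt orbT.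
  case: is_leafP => [->|tNa].
    move/absorbP => [nl nd w sub] /=; rewrite nl nd addn0 addn1; split=> // [n|].
      by rewrite w muln1 weight_pred.
    by move=> c /sub; apply: extendS => d dt; rewrite mem_cat dt.
  case: ifP a_st => [a_s _|_ /= a_t] /mapP[{}r r_in ->] /=.
    have [nl nd w sub] := IHs _ a_s r_in; rewrite -nl nd; split=> // [n|].
      by rewrite !expnD mulnACA [leqRHS]mulnACA leq_mul // weight_pred.
    exact: extend_catl.
  have [nl nd w sub] := IHt _ a_t r_in; rewrite -nl nd addnS; split=> // [n|].
    by rewrite !expnD mulnACA [leqRHS]mulnACA leq_mul // weight_pred.
  exact: extend_catr.
Qed.

(** The sibling of [a] does not contain that occurrence, so it offers at most [(nleaf t).-1] leaves
    to land on. *)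
Lemma size_red_absorb a t : a \in dleaves t ->
  size (red_absorb a t) <= (nleaf t).-1.
Proof.
elim: t => [u|s IH|s IHs t IHt] //=; first by move/IH; rewrite size_map.
rewrite mem_cat => a_st; case: is_leafP => [->|sNa].
  by rewrite (leq_trans (size_absorb _ _)).
case: is_leafP => [->|tNa].
  by rewrite /= addn1 (leq_trans (size_absorb _ _)).
have := nleaf_gt0 s; have := nleaf_gt0 t.
case: ifP a_st => [a_s _|_ /= a_t]; rewrite size_map.
  by move: (IHs a_s); lia.
by move: (IHt a_t); lia.
Qed.

Lemma red_crossP a t r : a \in dleaves t -> r \in red_cross a t ->
  [/\ nleaf r = nleaf t, (nder r).+1 = nder t &
      a != leaf X0 -> {subset letters r <= extend a (letters t)}].
Proof.
elim: t r => [u|s IH|s IHs t IHt] r //=.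
- move=> a_s; case: is_leafP => [->|_] /=.
    rewrite inE => /eqP-> /=; split=> // aX0 c; rewrite inE => /eqP->.
    by rewrite mem_cat /= eq_sym aX0 mem_head orbT.
  case/mapP=> {}r /(IH _ a_s)[nl nd sub] -> /=; rewrite nd; split=> // /sub.
  exact: extend_cons.
- rewrite mem_cat => a_st; case: is_leafP => [->|sNa].
    move/crossP => [nl nd sub] /=; rewrite nl nd; split=> // /sub {}sub c /sub.
    by apply: extendS => d dt; rewrite inE dt orbT.
  case: is_leafP => [->|tNa].
    move/crossP => [nl nd sub] /=; rewrite nl nd addn0 addn1.
    split=> // /sub {}sub c /sub.
    by apply: extendS => d dt; rewrite mem_cat dt.
  case: ifP a_st => [a_s _|_ /= a_t] /mapP[{}r r_in ->] /=.
    have [nl nd sub] := IHs _ a_s r_in; rewrite nl -nd; split=> // /sub.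
    exact: extend_catl.
  have [nl nd sub] := IHt _ a_t r_in; rewrite nl -nd addnS; split=> // /sub.
  exact: extend_catr.
Qed.

(** The bound of [weight_cross] is applied to the sibling; the strict inequality it requires comes
    from the leaf [a] outside that sibling. *)
Lemma weight_red_cross a t n : a \in dleaves t -> nleaf t <= n ->
  4 * n ^ 2 * (\sum_(r <- red_cross a t) weight n r) <= 2 * nleaf t * weight n t.
Proof.
elim: t => [u|s IH|s IHs t IHt] /= a_st le_n; first by rewrite big_nil muln0.
- case: is_leafP => [->|_] /=.
    by rewrite big_seq1 !muln1 (leq_trans (wt_ge n 1)) // leq_pmull.
  rewrite big_map /=.
  have -> : \sum_(r <- red_cross a s) wt n (nleaf r) * weight n r =
      wt n (nleaf s) * \sum_(r <- red_cross a s) weight n r.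
    rewrite big_distrr /= big_seq [RHS]big_seq.
    by apply: eq_bigr => r /(red_crossP a_st)[-> _ _].
  by rewrite mulnCA [leqRHS]mulnCA leq_mul2l IH ?orbT.
- move: a_st le_n; case: is_leafP => [->|sNa] a_st le_n.
    rewrite /= mul1n (leq_trans (weight_cross _ _)) //.
    by rewrite leq_mul2r leq_mul2l leq_addl !orbT.
  move: a_st le_n; case: is_leafP => [->|tNa] a_st le_n.
    rewrite /= muln1 (leq_trans (weight_cross _ _)) //; first by rewrite -addn1.
    by rewrite leq_mul2r leq_mul2l leq_addr !orbT.
  move: a_st; rewrite mem_cat.
  case: ifP => [a_s _|_ /= a_t]; rewrite big_map /=.
    rewrite -big_distrl /= mulnA [leqRHS]mulnA leq_mul2r.
    apply/orP; right; apply: leq_trans (IHs a_s _) _.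
      by apply: leq_trans le_n; rewrite leq_addr.
    by rewrite leq_mul2r leq_mul2l leq_addr !orbT.
  rewrite -big_distrr /= mulnCA [leqRHS]mulnCA leq_mul2l.
  apply/orP; right; apply: leq_trans (IHt a_t _) _.
    by apply: leq_trans le_n; rewrite leq_addl.
  by rewrite leq_mul2r leq_mul2l leq_addl !orbT.
Qed.

Lemma red_derP t r : 0 < nder t -> r \in red_der t ->
  [/\ nleaf r = nleaf t, (nder r).+1 = nder t &
      {subset letters r <= extend (leaf X0) (letters t)}].
Proof.
elim: t r => [u|s IH|s IHs t IHt] r //=.
- move=> _ /absorbP[-> -> _ sub]; split=> // c /sub.
  by apply: extendS => d ds; rewrite inE ds orbT.
- case: ifP => [nd_s _|nd_s nd_t] /mapP[{}r r_in ->] /=.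
    have [nl nd sub] := IHs _ nd_s r_in; rewrite nl -nd; split=> //.
    exact: extend_catl.
  have {}nd_t : 0 < nder t by move: nd_t; rewrite addn_gt0 nd_s.
  have [nl nd sub] := IHt _ nd_t r_in; rewrite nl -nd addnS; split=> //.
  exact: extend_catr.
Qed.

(** The derivation removed had weight at least [4 n^2], which pays for the at most [n] leaves it can
    land on. *)
Lemma weight_red_der t n : 0 < nder t -> nleaf t <= n ->
  \sum_(r <- red_der t) weight n r <= weight n t.
Proof.
elim: t => [u|s IH|s IHs t IHt] //=.
- move=> _ le_n; rewrite big_seq.
  rewrite (eq_bigr (fun=> weight n s)) => [|r /absorbP[_ _ -> _] //].
  rewrite -big_seq big_const_seq count_predT iter_addn_0 mulnC leq_mul //.
  rewrite (leq_trans (size_absorb _ _)) // (leq_trans le_n) //.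
  rewrite (leq_trans _ (wt_ge _ _)) //.
  by case: (n) => // k; rewrite expnS mulnCA leq_pmulr.
- case: ifP => [nd_s _|nd_s nd_t] le_n; rewrite big_map /=.
    rewrite -big_distrl leq_mul // IHs //.
    by apply: leq_trans le_n; rewrite leq_addr.
  have {}nd_t : 0 < nder t by move: nd_t; rewrite addn_gt0 nd_s.
  rewrite -big_distrr leq_mul // IHt //.
  by apply: leq_trans le_n; rewrite leq_addl.
Qed.

(** Bounds the number of signed Hall trees in the expansion of [t]. Without derivations it is
    [(p - 1)!] for [p] leaves. *)
Definition potential t := (nleaf t).-1`! * weight (nleaf t) t.

(** Let [t] have [p.+1] leaves. If it has a derivation, the absorbed terms take at most the fraction
    [p / p.+1] of the potential and the crossed terms at most [1 / p.+1]. Otherwise there are no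
    crossed terms, and at most [p] absorbed terms of potential [(p - 1)!] each. *)
Lemma potential_red a t : a \in dleaves t ->
  \sum_(r <- red_absorb a t) potential r + \sum_(r <- red_cross a t) potential r
    <= potential t.
Proof.
move=> a_t.
have [p pE] : exists p, nleaf t = p.+1.
  by exists (nleaf t).-1; rewrite prednK // nleaf_gt0.
have absorbE r : r \in red_absorb a t -> potential r = p.-1`! * weight p r.
  by case/(red_absorbP a_t); rewrite pE => -[nl] _ _ _; rewrite /potential nl.
have crossE r : r \in red_cross a t -> potential r = p`! * weight p.+1 r.
  by case/(red_crossP a_t)=> nl _ _; rewrite /potential nl pE.
have size_p : size (red_absorb a t) <= p.
  by rewrite (leq_trans (size_red_absorb a_t)) // pE.
(* For [p = 0] the list is empty, which makes up for [p.-1] being 0. *)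
have fact_p : size (red_absorb a t) * p.-1`! <= p`!.
  case: (p) size_p => [|q le_q]; first by rewrite leqn0 => /eqP->.
  by rewrite factS leq_mul.
have bound m W : (forall r, r \in red_absorb a t -> m * weight p r <= W) ->
    m * \sum_(r <- red_absorb a t) potential r <= p`! * W.
  move=> le_W; apply: (@leq_trans (\sum_(r <- red_absorb a t) p.-1`! * W)).
    rewrite big_distrr /= big_seq [leqRHS]big_seq; apply: leq_sum => r r_in.
    by rewrite absorbE // mulnCA leq_mul2l le_W ?orbT.
  rewrite big_const_seq count_predT iter_addn_0 mulnC mulnA.
  by rewrite leq_mul2r fact_p orbT.
rewrite /potential pE /= big_seq [X in _ + X]big_seq.
case nd_t: (nder t) => [|q].
  rewrite [X in _ + X]big1 => [|r /(red_crossP a_t)[_]]; last by rewrite nd_t.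
  rewrite addn0 -big_seq -[leqLHS]mul1n; apply: bound => r /(red_absorbP a_t)[_ _ w _].
  by have := w p; rewrite nd_t !expn0 !mul1n.
rewrite -big_seq (eq_bigr _ crossE) -big_distrr -big_seq /=.
have leA := bound p.+1 (p * weight p.+1 t).
(* One of the [q.+1] factors [p / p.+1] suffices; the others are bounded by 1. *)
have {leA bound}/leA leA r : r \in red_absorb a t ->
    p.+1 * weight p r <= p * weight p.+1 t.
  case/(red_absorbP a_t)=> _ _ w _; have := w p.
  rewrite nd_t !expnSr -!mulnA => le1.
  rewrite -(@leq_pmul2l (p.+1 ^ q)) ?expn_gt0 // (leq_trans le1) // leq_mul2r.
  by apply/orP; right; case: (q) => // k; rewrite leq_exp2r.
have := weight_red_cross a_t (eq_leq pE); rewrite pE.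
move: leA; move: (\sum_(r <- _) _) (\sum_(r <- _) _) => C A.
move: (weight _ _) p`! => W F leA leC.
have {}leC : p.+1 * C <= W.
  rewrite -(@leq_pmul2l (4 * p.+1)) //.
  rewrite mulnA -[_ * p.+1 * p.+1]mulnA (leq_trans leC) //.
  by rewrite leq_mul2r leq_mul2r orbT.
rewrite -(@leq_pmul2l p.+1) // mulnDr.
have : F * (p.+1 * C) <= F * W by rewrite leq_mul2l leC orbT.
nia.
Qed.

Lemma potential_red_der t : 0 < nder t ->
  \sum_(r <- red_der t) potential r <= potential t.
Proof.
move=> nd_t; rewrite /potential big_seq.
rewrite (eq_bigr (fun r => (nleaf t).-1`! * weight (nleaf t) r)); last first.
  by move=> r /(red_derP nd_t)[-> _ _].
by rewrite -big_seq -big_distrr leq_mul // weight_red_der.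
Qed.

End Weights.

(** * The Leibniz expansions in a Lie algebra *)

Section Evaluation.
Variables (X : choiceType) (X0 : X) (K : fieldType) (L : lieAlgType K).
Variable iota : X -> L.
Implicit Types (a h : Br X) (r s t : dtree X).

Fixpoint dev t : L :=
  match t with
  | Leaf h => ev iota h
  | Der s => lie (iota X0) (dev s)
  | Bin s t => lie (dev s) (dev t)
  end.

Lemma sum_dev_Der (l : seq (dtree X)) :
  \sum_(r <- map (@Der X) l) dev r = lie (iota X0) (\sum_(r <- l) dev r).
Proof. by rewrite big_map lie_sumr. Qed.

Lemma sum_dev_Binl (l : seq (dtree X)) t :
  \sum_(r <- map (@Bin X ^~ t) l) dev r = lie (\sum_(r <- l) dev r) (dev t).
Proof. by rewrite big_map lie_suml. Qed.

Lemma sum_dev_Binr (l : seq (dtree X)) t :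
  \sum_(r <- map (Bin t) l) dev r = lie (dev t) (\sum_(r <- l) dev r).
Proof. by rewrite big_map lie_sumr. Qed.

Definition sum_devE := (sum_dev_Der, sum_dev_Binl, sum_dev_Binr).

Lemma lie_dev a t : lie (ev iota a) (dev t) =
  \sum_(r <- absorb a t) dev r + \sum_(r <- cross X0 a t) dev r.
Proof.
elim: t => [u|s IH|s IHs t IHt] /=.
- rewrite big_nil addr0; case: eqVneq => [->|_]; first by rewrite big_nil lie_alt.
  by rewrite big_seq1.
- by rewrite lie_leibniz IH big_cons !sum_devE lieDr /= addrCA.
- by rewrite lie_leibniz IHs IHt !big_cat !sum_devE lieDl lieDr addrACA.
Qed.

(** There are no cross terms because [ad_X0] commutes with itself. *)
Lemma lie_dev_X0 t :
  lie (iota X0) (dev t) = \sum_(r <- absorb (leaf X0) t) dev r.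
Proof.
elim: t => [u|s IH|s IHs t IHt] /=.
- case: eqVneq => [->|_]; first by rewrite big_nil lie_alt.
  by rewrite big_seq1.
- by rewrite {1}IH sum_devE.
- by rewrite lie_leibniz IHs IHt !big_cat !sum_devE.
Qed.

(** The sign comes from antisymmetry, when [a] stands to the right of its sibling; under [Der] that
    sibling is [X0]. It is common to all terms. *)
Lemma dev_red a t : a \in dleaves t -> ~~ is_leaf a t ->
  exists e : bool, dev t = (-1) ^+ e *:
    (\sum_(r <- red_absorb a t) dev r + \sum_(r <- red_cross X0 a t) dev r).
Proof.
elim: t => [u|s IH|s IHs t IHt] /=.
- by rewrite inE eq_sym => ->.
- move=> a_s _; case: is_leafP => [->|/is_leafP sNa].
    exists true; rewrite big_nil add0r big_seq1 scaleN1r.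
    exact: lieC.
  have [//|e ->] := IH a_s; exists e.
  by rewrite !sum_devE -lieDr lieZr.
- rewrite mem_cat => a_st _; case: is_leafP => [->|/is_leafP sNa].
    by exists false; rewrite scale1r -lie_dev.
  case: is_leafP => [->|/is_leafP tNa].
    by exists true; rewrite scaleN1r -lie_dev [LHS]lieC.
  case: ifP a_st => [a_s _|_ /= a_t].
    have [//|e ->] := IHs a_s; exists e.
    by rewrite !sum_devE -lieDl lieZl.
  have [//|e ->] := IHt a_t; exists e.
  by rewrite !sum_devE -lieDr lieZr.
Qed.

Lemma dev_red_der t : (0 < nder t)%N -> dev t = \sum_(r <- red_der X0 t) dev r.
Proof.
elim: t => [u|s IH|s IHs t IHt] //=; first by move=> _; apply: lie_dev_X0.
case: ifP => [nd_s _|nd_s nd_t]; rewrite sum_devE; first by rewrite -IHs.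
by rewrite -IHt //; move: nd_t; rewrite addn_gt0 nd_s.
Qed.

Lemma letters_dleaves t c : c \in letters X0 t ->
  c \in dleaves t \/ (0 < nder t)%N /\ c = leaf X0.
Proof.
elim: t => [u|s IH|s IHs t IHt] /=; first by left.
  by rewrite inE => /predU1P[->|/IH[|[]]]; [right|left|right].
rewrite !mem_cat => /orP[/IHs|/IHt] [->|[nd ->]]; rewrite ?orbT; auto.
  by right; rewrite addn_gt0 nd.
by right; rewrite addn_gt0 nd orbT.
Qed.

End Evaluation.

(** * Growth of the Hall coordinates *)

Section HallSum.
Variables (X : choiceType) (B : set (Br X)) (K : fieldType) (L : lieAlgType K).
Variable iota : X -> L.
Implicit Types (u v : L) (n m : nat).

(** Counting signed trees with repetition gives an upper bound for the norm that is additive without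
    collecting coefficients. *)
Definition Hall_sum u n := exists s : seq (bool * Br X),
  [/\ (size s <= n)%N, {in s, forall e, B e.2} &
      u = \sum_(e <- s) (-1) ^+ e.1 *: ev iota e.2].

Lemma Hall_sum_ev c n : B c -> (0 < n)%N -> Hall_sum (ev iota c) n.
Proof.
move=> Bc n_gt0; exists [:: (false, c)]; split=> //.
  by move=> e; rewrite inE => /eqP->.
by rewrite big_seq1 scale1r.
Qed.

Lemma Hall_sumW u n m : (n <= m)%N -> Hall_sum u n -> Hall_sum u m.
Proof. by move=> lenm [s [le_s Bs ->]]; exists s; split=> //; apply: leq_trans lenm. Qed.

Lemma Hall_sum_sign u n (b : bool) : Hall_sum u n -> Hall_sum ((-1) ^+ b *: u) n.
Proof.
case=> s [le_s Bs ->]; exists [seq (b (+) e.1, e.2) | e <- s]; split.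
- by rewrite size_map.
- by move=> _ /mapP[e es ->]; apply: Bs es.
- rewrite big_map scaler_sumr; apply: eq_bigr => e _.
  by rewrite scalerA signr_addb.
Qed.

Lemma Hall_sumD u v n m : Hall_sum u n -> Hall_sum v m -> Hall_sum (u + v) (n + m).
Proof.
move=> [s [le_s Bs ->]] [r [le_r Br ->]]; exists (s ++ r); split.
- by rewrite size_cat leq_add.
- by move=> e; rewrite mem_cat => /orP[/Bs|/Br].
- by rewrite big_cat.
Qed.

Lemma Hall_sum_big (I : eqType) (r : seq I) (F : I -> L) (N : I -> nat) :
  {in r, forall i, Hall_sum (F i) (N i)} ->
  Hall_sum (\sum_(i <- r) F i) (\sum_(i <- r) N i).
Proof.
elim: r => [|i r IH] Hr.
  by exists [::]; rewrite !big_nil; split.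
rewrite !big_cons; apply: Hall_sumD; first by apply: Hr; rewrite mem_head.
by apply: IH => j jr; apply: Hr; rewrite inE jr orbT.
Qed.

End HallSum.

(** * Alphabets of Hall trees *)

Section Growth.
Variables (X : choiceType) (B : set (Br X)) (lt : Br X -> Br X -> Prop).
Hypothesis hallB : is_Hall_set B lt.
Variables (X0 : X) (K : fieldType) (L : lieAlgType K) (iota : X -> L).
Implicit Types (a b c h u v : Br X) (r s t : dtree X).

Definition left_le u v := if u is node u1 _ then lt u1 v \/ u1 = v else True.

(** By the Hall condition, the bracket of the least element with any other one is then a Hall
    tree. *)
Definition alphabet (l : seq (Br X)) :=
  {in l, forall u, B u} /\ {in l &, forall u v, left_le u v}.

(** In the extended set every left factor is at most [a], and every element is at least [a]. *)
Lemma alphabet_extend a (l : seq (Br X)) : alphabet l -> a \in l ->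
  {in l, forall c, c != a -> lt a c} -> alphabet (extend a l).
Proof.
move=> [Bl left_l] al amin; have Ba := Bl a al.
have Bnode u : u \in l -> u != a -> B (node a u).
  move=> ul ua; apply/(Hall_node hallB); split=> //; [exact: Bl|exact: amin|].
  exact: left_l.
have extP c : c \in extend a l ->
    c \in l \/ exists2 u, u \in l & u != a /\ c = node a u.
  rewrite mem_cat => /orP[|/mapP[u]]; first by left.
  by rewrite mem_filter => /andP[ua ul] ->; right; exists u.
split=> [c /extP[/Bl//|[u ul [ua ->]]]|
  c d /extP[cl|[u ul [ua ->]]] /extP[dl|[v vl [va ->]]]].
- exact: Bnode.
- exact: left_l.
- have [Bc Bn] : B c /\ B (node a v) by split; [apply: Bl|apply: Bnode].
  have lt_an := Hall_lt_node_l hallB Bn.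
  have := left_l c a cl al; case: (c) Bc => //= c1 c2 Bc [lt1a|->]; last by left.
  have [B1 _ _ _] := (Hall_node hallB c1 c2).1 Bc.
  by left; apply: (Hall_trans hallB B1 Ba Bn lt1a).
- by rewrite /left_le; have [->|da] := eqVneq d a; [right|left; apply: amin].
- left; apply: (Hall_lt_node_l hallB); exact: Bnode.
Qed.

Lemma alphabet_sub (l1 l2 : seq (Br X)) :
  {subset l1 <= l2} -> alphabet l2 -> alphabet l1.
Proof.
by move=> sub [Bl left_l]; split=> [u /sub/Bl|u v /sub ul /sub vl] //; apply: left_l.
Qed.

(** Induction on [nleaf t + nder t]: absorption removes a leaf, while crossing and [red_der] remove
    a derivation and keep the number of leaves. *)
Lemma Hall_sum_dev t : alphabet (letters X0 t) ->
  Hall_sum B iota (dev X0 iota t) (potential t).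
Proof.
move: {2}(nleaf t + nder t)%N (leqnn (nleaf t + nder t)) => n.
elim: n t => [|n IH] t le_n alph_t.
  by move: le_n; rewrite leqn0 addn_eq0 -leqn0 leqNgt nleaf_gt0.
have IHr r a : (nleaf r + nder r < nleaf t + nder t)%N ->
    a \in letters X0 t -> {in letters X0 t, forall c, c != a -> lt a c} ->
    {subset letters X0 r <= extend a (letters X0 t)} ->
    Hall_sum B iota (dev X0 iota r) (potential r).
  move=> lt_r a_t amin sub; apply: IH; first by rewrite -ltnS (leq_trans lt_r).
  exact: alphabet_sub sub (alphabet_extend alph_t a_t amin).
have t0 : letters X0 t != [::] by elim: (t) => //= s; case: letters.
have [a a_t amin] := Hall_min hallB alph_t.1 t0.
have [nd_t|nd_t] := boolP ((0 < nder t)%N && (a == leaf X0)).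
  case/andP: nd_t => nd_t /eqP a_X0; rewrite dev_red_der //.
  apply: Hall_sumW (potential_red_der X0 nd_t) _.
  apply: Hall_sum_big => r /(red_derP nd_t)[nl nd sub].
  apply: (IHr r a) => //; last by rewrite a_X0.
  by rewrite nl -nd addnS.
have a_leaf : a \in dleaves t.
  case: (letters_dleaves a_t) => // -[nd a_X0].
  by rewrite nd a_X0 eqxx in nd_t.
case: (boolP (is_leaf a t)) => [/is_leafP->|tNa].
  by apply: Hall_sum_ev; first exact: alph_t.1.
have [e ->] := dev_red X0 iota a_leaf tNa; apply: Hall_sum_sign.
apply: Hall_sumW (potential_red X0 a_leaf) _.
apply: Hall_sumD; apply: Hall_sum_big => r r_in.
  have [nl nd _ sub] := red_absorbP X0 a_leaf r_in.
  by apply: (IHr r a) => //; rewrite -nl nd.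
have [nl nd sub] := red_crossP a_leaf r_in.
apply: (IHr r a) => //; first by rewrite nl -nd addnS.
(* A crossed term exists only if [t] has a derivation; the case of a least letter [X0] being
   settled, [a] is not [leaf X0]. *)
by apply: sub; move: nd_t; rewrite -nd.
Qed.

(** * Hall trees as brackets with [X0] kept apart *)

Lemma occ_other_node b1 b2 :
  occ_other X0 (node b1 b2) = (occ_other X0 b1 + occ_other X0 b2)%N.
Proof.
rewrite /occ_other /br_size /occ /= size_cat count_cat.
by rewrite subnDA -addnBAC ?count_size // addnBA ?count_size.
Qed.

Lemma Hall_occ_other_gt0 b : B b -> b != leaf X0 -> (0 < occ_other X0 b)%N.
Proof.
elim: b => [x|b1 IH1 b2 IH2] Bb.
  rewrite /occ_other /occ /=.
  by case: (eqVneq x X0) => // ->; rewrite eqxx.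
have [B1 B2 lt12 _] := (Hall_node hallB b1 b2).1 Bb => _.
rewrite occ_other_node addn_gt0.
have [b1X0|/(IH1 B1)->//] := eqVneq b1 (leaf X0).
have [b2X0|/(IH2 B2)->] := eqVneq b2 (leaf X0); last by rewrite orbT.
by case: (Hall_irr hallB B1); rewrite {2}b1X0 -b2X0.
Qed.

Lemma occ_node b1 b2 : occ X0 (node b1 b2) = (occ X0 b1 + occ X0 b2)%N.
Proof. by rewrite /occ count_cat. Qed.

(** Nodes are opened from the root as long as their left factor exceeds [a]; the right factor then
    exceeds [a] too. A factor [X0] becomes a derivation, and every other leaf contains a letter
    different from [X0], whence the bound on [nleaf]. *)
Lemma flatten_Hall a b : B a -> B b -> lt a b -> b != leaf X0 ->
  exists t (e : bool), [/\ ev iota b = (-1) ^+ e *: dev X0 iota t,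
    {in letters X0 t, forall u, [/\ B u, lt a u & left_le u a]},
    (nleaf t <= occ_other X0 b)%N & (nder t <= occ X0 b)%N].
Proof.
move=> Ba; have leafP b' : B b' -> lt a b' -> b' != leaf X0 -> left_le b' a ->
  exists t (e : bool), [/\ ev iota b' = (-1) ^+ e *: dev X0 iota t,
    {in letters X0 t, forall u, [/\ B u, lt a u & left_le u a]},
    (nleaf t <= occ_other X0 b')%N & (nder t <= occ X0 b')%N].
  move=> Bb' ltab' b'X0 left_b'; exists (Leaf b'), false.
  split; rewrite ?scale1r //; last exact: Hall_occ_other_gt0.
  by move=> u; rewrite inE => /eqP->.
elim: b => [x|b1 IH1 b2 IH2] Bb ltab bX0; first exact: leafP.
have [B1 B2 lt12 _] := (Hall_node hallB b1 b2).1 Bb.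
have [lt1a|eq1a|lta1] := Hall_total hallB B1 Ba.
- by apply: leafP => //; left.
- by apply: leafP => //; right.
have lta2 : lt a b2 by apply: (Hall_trans hallB Ba B1 B2).
rewrite occ_other_node occ_node.
have [b1X0|/(IH1 B1 lta1)[t1 [e1 [ev1 let1 nl1 nd1]]]] := eqVneq b1 (leaf X0).
  have [b2X0|/(IH2 B2 lta2)[t2 [e2 [ev2 let2 nl2 nd2]]]] := eqVneq b2 (leaf X0).
    by case: (Hall_irr hallB B1); rewrite {2}b1X0 -b2X0.
  exists (Der t2), e2; split.
  - by rewrite /= ev2 lieZr b1X0.
  - move=> u; rewrite inE => /predU1P[->|/let2//].
    by rewrite -b1X0; split=> //; rewrite b1X0.
  - by rewrite (leq_trans nl2) // leq_addl.
  - by rewrite b1X0 /= {1}/occ /= eqxx ltnS.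
have [b2X0|/(IH2 B2 lta2)[t2 [e2 [ev2 let2 nl2 nd2]]]] := eqVneq b2 (leaf X0).
  exists (Der t1), (~~ e1); split.
  - by rewrite /= ev1 lieZl b2X0 lieC signrN scaleNr scalerN.
  - move=> u; rewrite inE => /predU1P[->|/let1//].
    by rewrite -b2X0; split=> //; rewrite b2X0.
  - by rewrite (leq_trans nl1) // leq_addr.
  - by rewrite b2X0 /= {2}/occ /= eqxx addn1 ltnS.
exists (Bin t1 t2), (e1 (+) e2); split; rewrite /= ?leq_add //.
- by rewrite ev1 ev2 lieZl lieZr scalerA signr_addb.
- by move=> u; rewrite mem_cat => /orP[/let1|/let2].
Qed.

(** The bound of [wt_le] for [n.+1] letters: [a] and at most [n] letters coming from [b]. *)
Definition growth_const n := (4 * n.+1 ^ 2 * 2 ^ n.+1)%N.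

Lemma growth_const_gt0 n : (0 < growth_const n)%N.
Proof. by rewrite !muln_gt0 !expn_gt0. Qed.

Lemma growth_const_mono n m : (n <= m)%N -> (growth_const n <= growth_const m)%N.
Proof. by move=> lenm; rewrite leq_mul ?leq_exp2l // leq_mul2l leq_exp2r. Qed.

Lemma Hall_sum_bracket a b : B a -> B b -> lt a b ->
  Hall_sum B iota (lie (ev iota a) (ev iota b))
    (growth_const (occ_other X0 b) ^ occ X0 b * (occ_other X0 b)`!).
Proof.
move=> Ba Bb ltab; have [bX0|bX0] := eqVneq b (leaf X0).
  apply: (@Hall_sum_ev _ _ _ _ _ (node a b)).
    by apply/(Hall_node hallB); split; rewrite // bX0.
  by rewrite muln_gt0 fact_gt0 expn_gt0 growth_const_gt0.
have [t [e [-> let_t nl nd]]] := flatten_Hall Ba Bb ltab bX0.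
have alph : alphabet (letters X0 (Bin (Leaf a) t)).
  have left_a c : B c -> left_le c a -> forall v, lt a v -> B v -> left_le c v.
    case: c => //= c1 c2 Bc [lt1|->] v ltav Bv; left=> //.
    have [B1 _ _ _] := (Hall_node hallB c1 c2).1 Bc.
    exact: (Hall_trans hallB B1 Ba Bv lt1).
  have left_aa : left_le a a.
    by case: (a) Ba => //= a1 a2 Ba'; left; apply: (Hall_lt_node_l hallB).
  split=> [u|u v]; rewrite /= !inE.
    by move=> /predU1P[->|/let_t[]].
  move=> /predU1P[->|/let_t[Bu ltau left_u]] /predU1P[->|/let_t[Bv ltav left_v]] //.
  - exact: left_a.
  - exact: left_a.
rewrite lieZr; apply: Hall_sum_sign.
apply: Hall_sumW (Hall_sum_dev alph).
(* The leaf [a] accounts for the predecessor in [potential], so the factorial is that of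
   [nleaf t]. *)
rewrite /potential /= mul1n mulnC leq_mul //; last exact: leq_fact.
apply: leq_trans (weight_le _ _) _.
apply: (@leq_trans (growth_const (occ_other X0 b) ^ nder t)).
  have [->//|nd_gt0] := posnP (nder t).
  by rewrite leq_exp2r // growth_const_mono.
by rewrite leq_pexp2l // growth_const_gt0.
Qed.

End Growth.

(** * Coordinates and the norm *)

Section HallNorm.
Variables (X : choiceType) (B : set (Br X)) (lt : Br X -> Br X -> Prop).
Hypothesis hallB : is_Hall_set B lt.
Variables (K : numFieldType) (L : lieAlgType K) (iota : X -> L).
Hypothesis freeL : is_free_lie iota.

Lemma Hall_coords_unique (u : L) alpha beta :
  Hall_coords iota B u alpha -> Hall_coords iota B u beta -> alpha = beta.
Proof.
move=> [Balpha ualpha] [Bbeta ubeta].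
pose A := (finsupp alpha `|` finsupp beta)%fset.
have widen (gamma : {fsfun Br X -> K with 0}) : (finsupp gamma `<=` A)%fset ->
    \sum_(c <- finsupp gamma) gamma c *: ev iota c =
    \sum_(c <- A) gamma c *: ev iota c.
  move=> sub; apply: big_fset_incl => // c _ /fsfun_dflt ->.
  exact: scale0r.
have eq0 : \sum_(c <- A) (alpha c - beta c) *: ev iota c = 0.
  transitivity (u - u); last exact: subrr.
  rewrite {1}ualpha ubeta !widen ?fsubsetUl ?fsubsetUr // -sumrB.
  by apply: eq_bigr => c _; rewrite scalerBl.
have indep := Hall_independent hallB freeL (fset_uniq A) _ eq0.
apply/fsfunP => c; apply/eqP; rewrite -subr_eq0; apply/eqP.
have [cA|] := boolP (c \in A).
  by apply: indep cA => d; rewrite inE => /orP[/Balpha|/Bbeta].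
by rewrite inE negb_or => /andP[/fsfun_dflt -> /fsfun_dflt ->]; rewrite subrr.
Qed.

(** Equal trees are collected; by the triangle inequality this does not raise the total. *)
Lemma Hall_sum_coords (u : L) n : Hall_sum B iota u n ->
  exists2 alpha, Hall_coords iota B u alpha &
    \sum_(c <- finsupp alpha) `|alpha c| <= n%:R.
Proof.
case=> s [le_s Bs ->].
pose A := [fset e.2 | e in s]%fset.
pose F c : K := \sum_(e <- s | e.2 == c) (-1) ^+ e.1.
pose alpha := [fsfun c in A => F c | 0] : {fsfun Br X -> K with 0}.
have alphaE c : alpha c = F c.
  rewrite fsfunE; case: ifP => // cA; rewrite /F big_seq_cond big1 // => e.
  by case/andP=> es /eqP ec; rewrite -ec in_imfset in cA.
have sub : (finsupp alpha `<=` A)%fset.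
  apply/fsubsetP => c; rewrite mem_finsupp fsfunE; case: ifP => //.
  by rewrite eqxx.
have pick (M : nmodType) (G : Br X -> bool * Br X -> M) :
    \sum_(c <- A) \sum_(e <- s | e.2 == c) G c e = \sum_(e <- s) G e.2 e.
  rewrite (exchange_big_dep xpredT) //= big_seq [RHS]big_seq.
  apply: eq_bigr => e es; rewrite -big_filter.
  rewrite (perm_big [:: e.2]) ?big_seq1 //; apply: uniq_perm => //.
    by rewrite filter_uniq ?fset_uniq.
  move=> c; rewrite mem_filter inE eq_sym andb_idr // => /eqP->.
  exact: in_imfset.
(* Signs may cancel, so the support can be smaller than [A]. *)
have widen (V : nmodType) (G : Br X -> V) : (forall c, alpha c = 0 -> G c = 0) ->
    \sum_(c <- finsupp alpha) G c = \sum_(c <- A) G c.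
  by move=> G0; apply: big_fset_incl => // c _ /fsfun_dflt /G0.
exists alpha; last first.
  rewrite widen => [|c ->]; last exact: normr0.
  apply: le_trans (_ : \sum_(e <- s) 1 <= _); last first.
    by rewrite big_const_seq count_predT iter_addr_0 ler_nat.
  rewrite -(pick _ (fun _ _ => 1)); apply: ler_sum => c _.
  rewrite alphaE; apply: le_trans (ler_norm_sum _ _ _) _.
  by apply: ler_sum => e _; rewrite normr_sign.
split=> [c /(fsubsetP sub)/imfsetP[e /= es ->]|]; first exact: Bs.
rewrite widen => [|c ->]; last exact: scale0r.
rewrite -(pick _ (fun c e => (-1) ^+ e.1 *: ev iota c)).
by apply: eq_bigr => c _; rewrite alphaE scaler_suml.
Qed.

Lemma Hall_norm_le (u : L) n :
  Hall_sum B iota u n -> (Hall_norm iota B u <= n%:R%:E)%E.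
Proof.
case/Hall_sum_coords=> alpha coords_alpha le_n.
(* Uniqueness identifies the coordinates chosen by [xget]; their existence excludes the default
   [+oo]. *)
rewrite /Hall_norm; case: xgetP => [y -> [beta coords_beta <-]|none].
  by rewrite lee_fin (Hall_coords_unique coords_beta coords_alpha).
by case: (none (\sum_(c <- finsupp alpha) `|alpha c|)%:E); exists alpha.
Qed.

End HallNorm.

Theorem theorem1p9 :
  exists C : nat -> nat,
  forall (R : realType) (K : numFieldType),
    K = (R : numFieldType) \/ K = (R[i] : numFieldType) ->
  forall (X : choiceType), (exists x y : X, x <> y) ->
  forall (L : lieAlgType K) (iota : X -> L), is_free_lie iota ->
  forall (B : set (Br X)) (lt : Br X -> Br X -> Prop), is_Hall_set B lt ->
  forall (X0 : X) (a b : Br X), B a -> B b -> lt a b ->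
    (Hall_norm iota B (lie (ev iota a) (ev iota b)) <=
      (C (occ_other X0 b) ^ occ X0 b * (occ_other X0 b)`!)%:R%:E)%E.
Proof.
exists growth_const => R K _ X _ L iota freeL B lt hallB X0 a b Ba Bb ltab.
exact/(Hall_norm_le hallB freeL)/(Hall_sum_bracket hallB).
Qed.
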